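(* Let $R$ be a finite chain ring, $T$ its Teichmüller set, $n\ge2$, and let $a(x),b(x)\in B_T$. (i) If $a(x)\sim_{n,T}b(x)$, then there exists an integer $0<k<n$ such that $a(x),b(x)\in B_{Tk}$. (ii) For each $0<k<n$, the relation $\sim_{n,T}$ induces an equivalence relation on $B_{Tk}$, and $B_T/\sim_{n,T}\;=\bigsqcup_{0<k<n}(B_{Tk}/\sim_{n,T})$. (iii) The number of equivalence classes of $\sim_{n,T}$ over $B_T$ equals the sum of the numbers of classes over each $B_{Tk}$, $0<k<n$. (iv) For $0<k<n$, if $a(x)=a_1x^k+a_0$ and $b(x)=b_1x^k+b_0$, then $a(x)\sim_{n,T}b(x)$ if and only if there exists $\alpha\in T^*$ such that $b_1\alpha^{n-k}-a_1=b_0\alpha^n-a_0=0$. (v) For $0<k<n$ and $a(x)\in B_{Tk}$, the $(n,T)$-equivalence class of $a(x)$ is $a(x)\star H_{Tk}$, and its cardinality is that of $H_{Tk}$. (vi) For $0<k<n$, the number of $(n,T)$-equivalence classes over $B_{Tk}$ is the index $[B_{Tk}:H_{Tk}]$ of the subgroup $H_{Tk}$ in $B_{Tk}$.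
   Context: A finite chain ring $R$ is a finite commutative local ring with identity whose ideals are linearly ordered by inclusion; let $p^r$ be the cardinality of its residue field. $R^\times$ contains a unique cyclic subgroup $T^*$ of order $p^r-1$, and $T=T^*\cup\{0\}$ is the Teichmüller set of $R$. For $0<k<n$, $B_k=\{b_1x^k+b_0\mid b_1,b_0\in R^\times\}\subset R[x]$, with coefficientwise product $(a_1x^k+a_0)\star(b_1x^k+b_0)=a_1b_1x^k+a_0b_0$ making it an abelian group, and $H_k=\{\alpha^{n-k}x^k+\alpha^n\mid\alpha\in R^\times\}$, a subgroup of $B_k$. $B_{Tk}$ and $H_{Tk}$ are the sets of those elements of $B_k$, respectively $H_k$, whose two coefficients lie in $T^*$; they are subgroups of $(B_k,\star)$. $B_T=\bigsqcup_{0<k<n}B_{Tk}$. For $a(x),b(x)\in B_T$, $a(x)\sim_{n,T}b(x)$ ($(n,T)$-equivalent) means that there exists $\alpha\in T^*$ such that $f(x)\mapsto f(\alpha x)$ is a (well-defined) $R$-algebra isomorphism $R[x]/\langle x^n-a(x)\rangle\to R[x]/\langle x^n-b(x)\rangle$; this is an equivalence relation on $B_T$. *)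

(* Defs.v *)
(* MathComp, with [boolp] from MathComp-Analysis for [`[< _ >]]. *)
From HB Require Import structures.
From mathcomp Require Import all_boot all_order all_fingroup all_algebra.
From mathcomp Require Import all_solvable.
From mathcomp Require Import boolp.

Set Implicit Arguments.
Unset Strict Implicit.
Unset Printing Implicit Defensive.

Import GRing.Theory.
Local Open Scope ring_scope.

Section ChainRing.
Variable R : finComUnitRingType.

Definition is_ideal (I : {set R}) : bool :=
  (0 \in I) && [forall a, forall u in I, forall v in I, a * u + v \in I].

Definition is_maximal_ideal (m : {set R}) : bool :=
  maxset (fun I : {set R} => is_ideal I && (1 \notin I)) m.

Definition local_ring : Prop := exists! m : {set R}, is_maximal_ideal m.

Definition finite_chain_ring : Prop :=
  local_ring /\
  forall I J : {set R}, is_ideal I -> is_ideal J -> (I \subset J) || (J \subset I).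

(* [#|[set: R] : m|] is the index of [m] in the additive group of [R], that is
   the cardinality of the residue field.  [T :\ 0] is then T^*. *)
Definition teichmuller_set (T : {set R}) : Prop :=
  exists (m : {set R}) (U : {group {unit R}}),
    [/\ is_maximal_ideal m,
        cyclic U,
        #|U| = (#|[set: R] : m|%g).-1
      & T = 0 |: [set FinRing.uval u | u in U]].

End ChainRing.

Section Binomials.
Variable R : finComUnitRingType.

(* All the polynomials considered have degree less than [n]; they are taken in
   the finite type [{poly_n R}], so that classes can be counted. *)
Definition B (n k : nat) : {set {poly_n R}} :=
  [set f : {poly_n R} | [exists b1 : R, exists b0 : R,
     [&& b1 \is a GRing.unit, b0 \is a GRing.unit
       & (f : {poly R}) == b1 *: 'X^k + b0%:P]]].

Definition H (n k : nat) : {set {poly_n R}} :=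
  [set f : {poly_n R} | [exists alpha : R,
     (alpha \is a GRing.unit) &&
     ((f : {poly R}) == alpha ^+ (n - k) *: 'X^k + (alpha ^+ n)%:P)]].

(* On [B n k] this is
   (a1 X^k + a0) * (b1 X^k + b0) = a1 b1 X^k + a0 b0. *)
Definition star (n : nat) (f g : {poly_n R}) : {poly_n R} :=
  mk_npoly n (fun i => f`_i * g`_i).

Definition coefs_in (S : {set R}) (n k : nat) (f : {poly_n R}) : bool :=
  (f`_k \in S) && (f`_0 \in S).

Definition BTk (T : {set R}) (n k : nat) : {set {poly_n R}} :=
  [set f in B n k | coefs_in (T :\ 0) k f].

(* The coefficients of an element lie in T^*, not necessarily the unit [alpha]
   that witnesses its membership in [H n k]. *)
Definition HTk (T : {set R}) (n k : nat) : {set {poly_n R}} :=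
  [set f in H n k | coefs_in (T :\ 0) k f].

Definition BT (T : {set R}) (n : nat) : {set {poly_n R}} :=
  \bigcup_(k < n | (0 < k)%N) BTk T n k.

(* [{poly %/ 'X^n - a}] is R[X]/<X^n - a>, because 'X^n - a is monic of degree
   n as soon as 0 < n.  The existence of [phi] on the quotient expresses that
   f(X) |-> f(alpha X) is well defined modulo these polynomials. *)
Definition nT_equiv (T : {set R}) (n : nat) (a b : {poly_n R}) : Prop :=
  exists2 alpha : R, alpha \in T :\ 0 &
  exists phi : {lrmorphism {poly %/ 'X^n - (a : {poly R})} ->
                           {poly %/ 'X^n - (b : {poly R})}},
    bijective phi /\
    forall f : {poly R},
      phi (in_qpoly ('X^n - (a : {poly R})) f) =
      in_qpoly ('X^n - (b : {poly R})) (f \Po (alpha *: 'X)).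

Definition nT_equivb (T : {set R}) (n : nat) : rel {poly_n R} :=
  fun a b => `[< nT_equiv T a b >].

(* As a set of equivalence classes, contained in [D]. *)
Definition nT_classes (T : {set R}) (n : nat) (D : {set {poly_n R}}) :
    {set {set {poly_n R}}} :=
  equivalence_partition (nT_equivb T (n := n)) D.

End Binomials.

(* The abelian group (B_k, star); the hypothesis [hk] on the exponents is what
   makes [Bgroup hk] a group. *)
Section BGroup.
Variables (R : finComUnitRingType) (n k : nat).

Definition Bgroup (hk : (0 < k < n)%N) : predArgType :=
  {f : {poly_n R} | f \in B R n k}.

Hypothesis hk : (0 < k < n)%N.

HB.instance Definition _ := SubFinite.on (Bgroup hk).

Lemma BP (f : {poly_n R}) :
  reflect [/\ f`_k \is a GRing.unit, f`_0 \is a GRing.unit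
            & forall i, i != k -> i != 0%N -> f`_i = 0]
          (f \in B R n k).
Proof.
have /andP[k0 kn] := hk; have k0' : (k == 0)%N = false by case: (k) k0.
rewrite inE; apply: (iffP existsP) => [[b1 /existsP[b0 /and3P[u1 u0 /eqP->]]]|].
  split=> [||i ik i0]; rewrite coefD coefZ coefXn coefC.
  - by rewrite eqxx k0' mulr1 addr0.
  - by rewrite eq_sym k0' mulr0 add0r.
  - by rewrite (negPf ik) (negPf i0) mulr0 addr0.
case=> u1 u0 h; exists f`_k; apply/existsP; exists f`_0; rewrite u1 u0 /=.
apply/eqP/polyP => i; rewrite coefD coefZ coefXn coefC.
case: (eqVneq i k) => [->|ik]; first by rewrite k0' mulr1 addr0.
case: (eqVneq i 0%N) => [->|i0]; first by rewrite mulr0 add0r.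
by rewrite mulr0 addr0 h.
Qed.

Lemma coef_star (f g : {poly_n R}) i : (star f g)`_i = f`_i * g`_i.
Proof.
rewrite coef_poly; case: ltnP => // ni.
by rewrite [f`_i]nth_default ?mul0r // (leq_trans (size_npoly f)).
Qed.

Lemma star_in (f g : {poly_n R}) :
  f \in B R n k -> g \in B R n k -> star f g \in B R n k.
Proof.
move=> /BP[f1 f0 fh] /BP[g1 g0 gh]; apply/BP.
split=> [||i ik i0]; rewrite coef_star ?unitrM ?f1 ?f0 //.
by rewrite fh // mul0r.
Qed.

Lemma Bone_in : npolyp n ('X^k + 1) \in B R n k.
Proof.
have /andP[k0 kn] := hk.
have s : (size ('X^k + 1 : {poly R})%R <= n)%N.
  rewrite (leq_trans (size_polyD _ _)) // geq_max size_polyXn kn.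
  by rewrite size_poly1 (leq_trans _ kn).
rewrite inE; apply/existsP; exists 1; apply/existsP; exists 1.
by rewrite unitr1 npolypK // scale1r polyC1 eqxx.
Qed.

Definition Binv (f : {poly_n R}) : {poly_n R} :=
  mk_npoly n (fun i => (f`_i)^-1).

Lemma coef_Binv (f : {poly_n R}) i : (Binv f)`_i = (f`_i)^-1.
Proof.
rewrite coef_poly; case: ltnP => // ni.
by rewrite [f`_i]nth_default ?invr0 // (leq_trans (size_npoly f)).
Qed.

Lemma Binv_in (f : {poly_n R}) : f \in B R n k -> Binv f \in B R n k.
Proof.
move=> /BP[f1 f0 fh]; apply/BP.
split=> [||i ik i0]; rewrite coef_Binv ?unitrV //.
by rewrite fh // invr0.
Qed.

Let mkB (f : {poly_n R}) (hf : f \in B R n k) : Bgroup hk :=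
  exist (fun g : {poly_n R} => is_true (g \in B R n k)) f hf.

Definition Bgroup_mul (f g : Bgroup hk) : Bgroup hk :=
  mkB (star_in (valP f) (valP g)).
Definition Bgroup_one : Bgroup hk := mkB Bone_in.
Definition Bgroup_inv (f : Bgroup hk) : Bgroup hk :=
  mkB (Binv_in (valP f)).

Lemma coef_Bone i :
  (val Bgroup_one)`_i = ((i == k) || (i == 0%N))%:R.
Proof.
have /andP[k0 kn] := hk.
rewrite /= coef_npolyp; case: ltnP => [_|ni]; last first.
  have ki := leq_trans kn ni; rewrite gtn_eqF // gtn_eqF //.
  exact: leq_trans ki.
rewrite coefD coefXn coef1.
case: (eqVneq i k) => [->|_]; last by rewrite add0r.
by case: (k) k0 => // ? _; rewrite addr0.
Qed.

Lemma Bgroup_ext (f g : Bgroup hk) :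
  (forall i, (val f)`_i = (val g)`_i) -> f = g.
Proof. by move=> h; apply/val_inj/val_inj/polyP. Qed.

Lemma Bgroup_mulA : associative Bgroup_mul.
Proof. by move=> f g h; apply: Bgroup_ext => i; rewrite !coef_star mulrA. Qed.

Lemma Bgroup_mul1 : left_id Bgroup_one Bgroup_mul.
Proof.
move=> f; apply: Bgroup_ext => i; rewrite coef_star coef_Bone.
have /BP[_ _ h] := valP f.
case: (eqVneq i k) => [_|ik]; first by rewrite mul1r.
by case: (eqVneq i 0%N) => [_|i0]; rewrite ?mul1r // h ?mulr0.
Qed.

Lemma Bgroup_mulV : left_inverse Bgroup_one Bgroup_inv Bgroup_mul.
Proof.
move=> f; apply: Bgroup_ext => i; rewrite coef_star coef_Bone coef_Binv.
have /BP[u1 u0 h] := valP f.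
case: (eqVneq i k) => [->|ik]; first by rewrite mulVr.
case: (eqVneq i 0%N) => [->|i0]; first by rewrite mulVr.
by rewrite h ?mulr0.
Qed.

HB.instance Definition _ :=
  Finite_isGroup.Build (Bgroup hk) Bgroup_mulA Bgroup_mul1 Bgroup_mulV.

End BGroup.

Arguments Bgroup R {n k} hk.

(* Main.v *)
(* The substitution X -> alpha X induces an isomorphism R[X]/<X^n - a> ->
   R[X]/<X^n - b> iff X^n - b divides alpha^n X^n - a(alpha X), that is, since
   a and b have degree less than n, iff alpha^n b_i = alpha^i a_i for all i.
   For alpha in T^* this preserves the support {0, k}, and on B_Tk it says that
   a and b differ by the factor alpha^(n-k) X^k + alpha^n; the classes are
   therefore cosets, all of the same size.  These factors exhaust H_Tk because
   |R^x| = |m| (q - 1) with |m| and q - 1 coprime, q = |R/m|, so that T^* is a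
   Hall subgroup of R^x: if alpha^i lies in T^*, it equals the i-th power of
   the T^*-component of alpha. *)
Require Import Defs.
From HB Require Import structures.
From mathcomp Require Import all_boot all_order all_fingroup all_algebra.
From mathcomp Require Import all_solvable.
From mathcomp Require Import boolp.

Set Implicit Arguments.
Unset Strict Implicit.
Unset Printing Implicit Defensive.

Import GRing.Theory.
Local Open Scope ring_scope.
Import Pdiv.CommonRing Pdiv.RingMonic.

(** * Substitution maps between quotients of [{poly A}] by monic polynomials *)

Section Substitution.
Variable A : comNzRingType.

Lemma in_qpolyK (h : {poly A}) (p : {poly %/ h}) : in_qpoly h p = p.
Proof. by apply: val_inj; rewrite /= rmodp_small ?size_mk_monic. Qed.

Lemma coef_comp_scaleX (p : {poly A}) (c : A) (i : nat) :
  (p \Po (c *: 'X))`_i = c ^+ i * p`_i.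
Proof.
rewrite coef_comp_poly; have [ip|pi] := ltnP i (size p).
  rewrite (bigD1 (Ordinal ip)) //= exprZn coefZ coefXn eqxx mulr1 mulrC.
  rewrite big1 ?addr0 // => j; rewrite -val_eqE /= eq_sym => /negPf ji.
  by rewrite exprZn coefZ coefXn ji !mulr0.
rewrite [p`_i]nth_default // mulr0 big1 // => j _.
rewrite exprZn coefZ coefXn gtn_eqF ?mulr0 ?mulr0 //.
exact: leq_trans (ltn_ord j) pi.
Qed.

Lemma comp_scaleXK (c d : A) (p : {poly A}) :
  c * d = 1 -> p \Po (c *: 'X) \Po (d *: 'X) = p.
Proof.
move=> cd; apply/polyP => i.
by rewrite !coef_comp_scaleX mulrA -exprMn [d * c]mulrC cd expr1n mul1r.
Qed.

Section Lift.
Variables (h g q : {poly A}).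
Hypothesis hq : in_qpoly g (mk_monic h \Po q) = 0.

Definition qpoly_subst (p : {poly %/ h}) : {poly %/ g} :=
  in_qpoly g ((p : {poly A}) \Po q).

(** Independence of the representative: dividing [f] by [mk_monic h] leaves the remainder plus a
    multiple of [mk_monic h], and [hq] kills the latter after substitution. *)
Lemma qpoly_subst_in (f : {poly A}) :
  qpoly_subst (in_qpoly h f) = in_qpoly g (f \Po q).
Proof.
rewrite [in RHS](rdivp_eq (monic_mk_monic h) f) comp_polyD comp_polyM.
by rewrite in_qpolyD in_qpolyM hq mulr0 add0r.
Qed.

Lemma qpoly_subst_linear : linear qpoly_subst.
Proof.
move=> c u v; rewrite -[u]in_qpolyK -[v]in_qpolyK -in_qpolyZ -in_qpolyD.
by rewrite !qpoly_subst_in comp_polyD comp_polyZ in_qpolyD in_qpolyZ.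
Qed.

Lemma qpoly_subst_monoid_morphism : monoid_morphism qpoly_subst.
Proof.
split=> [|u v]; first by rewrite -in_qpoly1 qpoly_subst_in comp_polyC in_qpoly1.
rewrite -[u]in_qpolyK -[v]in_qpolyK -in_qpolyM !qpoly_subst_in.
by rewrite comp_polyM in_qpolyM.
Qed.

HB.instance Definition _ :=
  GRing.isLinear.Build A {poly %/ h} {poly %/ g} _ qpoly_subst qpoly_subst_linear.
HB.instance Definition _ :=
  GRing.isMonoidMorphism.Build {poly %/ h} {poly %/ g} qpoly_subst
    qpoly_subst_monoid_morphism.

Lemma qpoly_subst_lrmorphism :
  exists phi : {lrmorphism {poly %/ h} -> {poly %/ g}},
    forall f, phi (in_qpoly h f) = in_qpoly g (f \Po q).
Proof. by exists qpoly_subst; apply: qpoly_subst_in. Qed.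

End Lift.

(** The type [{poly %/ h}] reduces modulo [mk_monic h], which falls back to ['X] unless [h] is monic
    and nonconstant. The degree bound on [a] excludes this fallback. *)
Lemma mk_monic_XnsubC (n : nat) (a : {poly_n A}) :
  (0 < n)%N -> mk_monic ('X^n - (a : {poly A})) = 'X^n - (a : {poly A}).
Proof.
move=> n0; have sa : (size (- (a : {poly A})) < size ('X^n : {poly A}))%N.
  by rewrite size_polyN size_polyXn ltnS size_npoly.
rewrite /mk_monic size_polyDl // size_polyXn ltnS n0 /=.
by rewrite monicE lead_coefDl // lead_coefXn eqxx.
Qed.

(* Modulo [X^n - b] the substituted polynomial is [c^n b - a(cX)], which has
   degree less than [n]. *)
Lemma in_qpoly_subst_eq0 (n : nat) (a b : {poly_n A}) (c : A) : (0 < n)%N ->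
  in_qpoly ('X^n - (b : {poly A})) (('X^n - (a : {poly A})) \Po (c *: 'X)) = 0 <->
  (forall i, b`_i * c ^+ n = a`_i * c ^+ i).
Proof.
move=> n0; set g := 'X^n - _.
have mg : mk_monic g = g by exact: mk_monic_XnsubC.
have sg : size g = n.+1.
  by rewrite size_polyDl size_polyXn // size_polyN ltnS size_npoly.
pose d : {poly A} := c ^+ n *: (b : {poly A}) - ((a : {poly A}) \Po (c *: 'X)).
have dE i : d`_i = b`_i * c ^+ n - a`_i * c ^+ i.
  by rewrite /d coefB coefZ coef_comp_scaleX mulrC [_ * a`_i]mulrC.
have sd : (size d < size (mk_monic g))%N.
  rewrite mg sg ltnS; apply/leq_sizeP => i ni.
  by rewrite dE !big_coef_npoly // !mul0r subr0.
have -> : ('X^n - (a : {poly A})) \Po (c *: 'X) = c ^+ n *: g + d.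
  by rewrite comp_polyB comp_Xn_poly exprZn scalerBr addrA subrK.
have gg : in_qpoly g g = 0.
  by apply: val_inj; rewrite /= mg rmodpp // -mg monic_mk_monic.
rewrite in_qpolyD in_qpolyZ gg scaler0 add0r; split=> [d0 i|hc].
  apply/eqP; rewrite -subr_eq0 -dE -(in_qpoly_small sd) d0.
  by rewrite [X in X == _]coef0.
suff -> : d = 0 by rewrite in_qpoly0.
by apply/polyP => i; rewrite dE hc subrr coef0.
Qed.
End Substitution.

(** Exchanging the two polynomials turns [c] into its inverse; this gives both the inverse
    isomorphism and the symmetry of the relation. *)
Lemma scaled_coefV (S : comUnitRingType) (x y c : S) (i n : nat) :
  c \is a GRing.unit -> y * c ^+ n = x * c ^+ i ->
  x * c^-1 ^+ n = y * c^-1 ^+ i.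
Proof.
move=> uc xy; rewrite !exprVn -[x](mulrK (unitrX i uc)) -xy.
by rewrite mulrAC mulrK // unitrX.
Qed.

(** * Equivalence as a condition on coefficients *)

Section Equiv.
Variables (R : finComUnitRingType) (T : {set R}) (n : nat).
Hypotheses (n0 : (0 < n)%N) (Tunit : {in T :\ 0, forall x, x \is a GRing.unit}).

Lemma nT_equivP (a b : {poly_n R}) :
  nT_equiv T a b <->
  exists2 c, c \in T :\ 0 & forall i, b`_i * c ^+ n = a`_i * c ^+ i.
Proof.
split=> -[c Tc].
  case=> phi [_ phiE]; exists c => //; apply/(in_qpoly_subst_eq0 a b c n0).
  (* The class of X^n - a is zero in the source, so [phi] must send it to zero. *)
  rewrite -phiE -[X in phi X](_ : 0 = _) ?raddf0 //; apply: val_inj => /=.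
  by rewrite -[X in rmodp X _](mk_monic_XnsubC a n0) rmodpp ?monic_mk_monic.
move=> hc; exists c => //; have uc := Tunit Tc.
have hd i := scaled_coefV uc (hc i).
have /qpoly_subst_lrmorphism[phi phiE] :
    in_qpoly ('X^n - (b : {poly R}))
      (mk_monic ('X^n - (a : {poly R})) \Po (c *: 'X)) = 0.
  by rewrite mk_monic_XnsubC //; apply/in_qpoly_subst_eq0.
have /qpoly_subst_lrmorphism[psi psiE] :
    in_qpoly ('X^n - (a : {poly R}))
      (mk_monic ('X^n - (b : {poly R})) \Po (c^-1 *: 'X)) = 0.
  by rewrite mk_monic_XnsubC //; apply/in_qpoly_subst_eq0.
(* The substitutions X -> cX and X -> c^-1 X cancel each other already on polynomials. *)
exists phi; split=> //; exists psi => u; rewrite -[u]in_qpolyK.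
  by rewrite phiE psiE comp_scaleXK ?mulrV.
by rewrite psiE phiE comp_scaleXK ?mulVr.
Qed.
End Equiv.

(** * Units and residue field of a finite local ring *)

Section Local.
Variable R : finComUnitRingType.
Implicit Types m I : {set R}.

Lemma is_idealP I :
  reflect [/\ 0 \in I & forall a u v, u \in I -> v \in I -> a * u + v \in I]
          (is_ideal I).
Proof.
apply: (iffP andP) => -[I0]; last first.
  move=> h; split=> //; apply/forallP => a; apply/forall_inP => u Iu.
  by apply/forall_inP => v Iv; apply: h.
move=> /forallP h; split=> // a u v Iu Iv.
by have /forall_inP/(_ u Iu)/forall_inP/(_ v Iv) := h a.
Qed.

Lemma ideal_addgroup I : is_ideal I -> group_set I.
Proof.
case/is_idealP=> I0 h; apply/group_setP; split=> // u v Iu Iv.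
by rewrite -[u]mul1r; apply: h.
Qed.

Lemma is_ideal_principal (x : R) : is_ideal [set a * x | a : R].
Proof.
apply/is_idealP; split; first by apply/imsetP; exists 0; rewrite ?mul0r.
move=> a _ _ /imsetP[b _ ->] /imsetP[c _ ->].
by apply/imsetP; exists (a * b + c); rewrite // mulrDl mulrA.
Qed.

(** A nonunit generates a proper ideal, which lies in some maximal ideal; by uniqueness that ideal
    is [m]. *)
Lemma local_nonunit m (x : R) : local_ring R -> is_maximal_ideal m ->
  (x \in m) = (x \isn't a GRing.unit).
Proof.
move=> [m' [_ m'uniq]] maxm; have mE := m'uniq _ maxm.
have /maxsetP[/andP[/is_idealP[m0 mI] m1] _] := maxm.
apply/idP/idP => [mx|nux].
  apply: contra m1 => ux; rewrite -(mulVr ux) -[_ * x]addr0.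
  exact: mI.
pose I := [set a * x | a : R].
have [M maxM sIM] : {M | is_maximal_ideal M & I \subset M}.
  apply: maxset_exists; rewrite is_ideal_principal /=.
  apply: contra nux => /imsetP[a _ ax1]; apply/unitrPr; exists a.
  by rewrite mulrC -ax1.
rewrite -mE (m'uniq _ maxM); apply: (subsetP sIM).
by apply/imsetP; exists 1; rewrite ?mul1r.
Qed.

Variable m : {set R}.
Hypotheses (locR : local_ring R) (maxm : is_maximal_ideal m).

Let m_ideal : is_ideal m.
Proof. by have /maxsetP[/andP[]] := maxm. Qed.
Let M : {group R} := Group (ideal_addgroup m_ideal).

Lemma card_local_units :
  #|[set: {unit R}]| = (#|m| * (#|[set: R] : m|%g).-1)%N.
Proof.
have := Lagrange (subsetT M); rewrite /= => hL.
rewrite -subn1 mulnBr muln1 hL -(card_imset _ val_inj).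
have -> : [set val u | u in [set: {unit R}]] = ~: m.
  apply/setP=> x; rewrite inE (local_nonunit _ locR maxm) negbK.
  apply/imsetP/idP => [[u _ ->]|ux]; first exact: (valP u).
  by exists (FinRing.unit R ux).
by rewrite cardsT -(cardsC m) addKn.
Qed.

(** Let a prime p divide both |m| and q - 1, where q = |R/m|. Then p and q, as elements of [R], both
    lie in [m], hence so does 1 = q - (q - 1), a contradiction. *)
Lemma coprime_local : coprime #|m| (#|[set: R] : m|%g).-1.
Proof.
apply/negPn/negP => ncop; pose q := #|[set: R] : m|%g; rewrite -/q in ncop.
have pr_p : prime (pdiv (gcdn #|m| q.-1)).
  by rewrite pdiv_prime // ltn_neqAle eq_sym ncop gcdn_gt0 (cardG_gt0 M).
set p := pdiv _ in pr_p.
have := pdiv_dvd (gcdn #|m| q.-1); rewrite -/p dvdn_gcd => /andP[pm pq].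
have [x _ ox] := Cauchy (G := M) pr_p pm.
have [m0 mI] := is_idealP _ m_ideal.
have mMn (c : nat) : p%:R * c%:R \in m.
  rewrite -[_ * _]addr0 mulrC; apply: mI => //.
  (* Cauchy's theorem gave [x] of additive order [p]. If [p] were a unit, p x = 0 would force x = 0,
     which has order 1. *)
  rewrite (local_nonunit _ locR maxm); apply/negP => up.
  have := expg_order x; rewrite ox FinRing.zmodXgE -mulr_natl => px0.
  have x0 : x = 0 by apply: (mulrI up); rewrite mulr0.
  by move: ox pr_p; rewrite x0 order1 => <-.
have mq : q%:R \in m.
  (* The order q of the additive group R/m kills the class of the ring unit. Here [e ^+ i] is a
     power in the additive group, that is, the multiple i times 1. *)
  pose e : R := 1.
  have nM : [set: R] \subset 'N(M)%g.
    by rewrite sub_abelian_norm ?FinRing.zmod_abelian ?subsetT.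
  have nMe i : (e ^+ i)%g \in 'N(M)%g by rewrite (subsetP nM) ?inE.
  have : (coset M e ^+ #|[set: R] / M| = 1)%g.
    by rewrite expg_cardG // mem_quotient // inE.
  rewrite card_quotient // -morphX ?(nMe 1%N) // => q1.
  have : (e ^+ q)%g \in M by exact: coset_idr (nMe q) q1.
  by rewrite FinRing.zmodXgE.
have qS : q%:R = q.-1%:R + 1 :> R by rewrite natr1 prednK ?(indexg_gt0 _ M).
have : 1 \in m.
  have -> : 1 = (-1) * (p%:R * (q.-1 %/ p)%:R) + q%:R :> R.
    by rewrite -natrM mulnC divnK // qS addrA mulN1r addNr add0r.
  exact: mI.
by rewrite (local_nonunit _ locR maxm) unitr1.
Qed.
End Local.

(** * T^* as a Hall subgroup of the unit group *)

Section Teichmuller.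
Variables (R : finComUnitRingType) (T : {set R}).
Hypotheses (locR : local_ring R) (hT : teichmuller_set T).

(** Since |R^x| = |m| |U| with |m| coprime to |U|, the part of |R^x| at the primes of |U| is |U|
    itself. *)
Lemma teichmuller_hall : exists U : {group {unit R}},
  T :\ 0 = [set FinRing.uval u | u in U] /\ (\pi(U).-Hall([set: {unit R}]) U)%g.
Proof.
have [m [U [maxm _ cardU ->]]] := hT; exists U; split.
  apply/setP=> x; rewrite !inE.
  case: eqVneq => [->|//] /=; apply/esym/negP => /imsetP[u _ u0].
  by have := valP u; rewrite /= -u0 unitr0.
have m_gt0 : (0 < #|m|)%N.
  have /maxsetP[/andP[/ideal_addgroup gm _] _] := maxm.
  exact: (cardG_gt0 (Group gm)).
rewrite pHallE subsetT (card_local_units locR maxm) -cardU /=.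
rewrite partnM ?cardG_gt0 // [X in (_ * X)%N]part_pnat_id ?pnat_pi ?cardG_gt0 //.
rewrite part_p'nat ?mul1n // -coprime_pi' ?cardG_gt0 // coprime_sym cardU.
exact: coprime_local.
Qed.

Lemma teichmuller_unit : {in T :\ 0, forall x, x \is a GRing.unit}.
Proof.
have [U [-> _]] := teichmuller_hall => x /imsetP[u _ ->]; exact: (valP u).
Qed.

Lemma teichmuller1 : 1 \in T :\ 0.
Proof.
by have [U [-> _]] := teichmuller_hall; apply/imsetP; exists 1%g; rewrite ?group1.
Qed.

Lemma teichmullerM : {in T :\ 0 &, forall x y, x * y \in T :\ 0}.
Proof.
have [U [-> _]] := teichmuller_hall => _ _ /imsetP[u Uu ->] /imsetP[v Uv ->].
by apply/imsetP; exists (u * v)%g; rewrite ?groupM.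
Qed.

Lemma teichmullerV : {in T :\ 0, forall x, x^-1 \in T :\ 0}.
Proof.
have [U [-> _]] := teichmuller_hall => _ /imsetP[u Uu ->].
by apply/imsetP; exists u^-1%g; rewrite ?groupV.
Qed.

Lemma teichmullerX (i : nat) : {in T :\ 0, forall x, x ^+ i \in T :\ 0}.
Proof.
move=> x Tx; elim: i => [|i IH]; first by rewrite expr0 teichmuller1.
by rewrite exprS teichmullerM.
Qed.

(* [beta] is the Hall component of [alpha] in T^*.  Since [HTk] allows any unit
   [alpha], this is what makes its elements come from T^*. *)
Lemma teichmuller_component (alpha : R) : alpha \is a GRing.unit ->
  exists2 beta, beta \in T :\ 0 &
    forall i, alpha ^+ i \in T :\ 0 -> alpha ^+ i = beta ^+ i.
Proof.
move=> ua; have [U [-> hallU]] := teichmuller_hall.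
pose a := FinRing.unit R ua.
have nU : (U <| [set: {unit R}])%g.
  rewrite -sub_abelian_normal ?subsetT //.
  by apply/centsP => x _ y _; apply: val_inj; rewrite /= mulrC.
(* A normal Hall subgroup consists of all elements whose order involves only its primes. *)
have memU x := mem_normal_Hall hallU nU (in_setT x).
exists (val (a.`_\pi(U))%g).
  by apply/imsetP; exists (a.`_\pi(U))%g => //; rewrite memU p_elt_constt.
move=> i /imsetP[u Uu au]; rewrite -FinRing.val_unitX.
have aX : (a ^+ i)%g = u by apply: val_inj; rewrite FinRing.val_unitX.
(* Taking components commutes with powers, and an element of [U] is its own component. *)
by rewrite -consttX constt_p_elt -?memU aX.
Qed.
End Teichmuller.

(** * The equivalence relation and its classes over B_T *)

Section Classes.
Variables (R : finComUnitRingType) (T : {set R}) (n : nat).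
Hypotheses (locR : local_ring R) (hT : teichmuller_set T) (n_gt0 : (0 < n)%N).
Implicit Types a b f : {poly_n R}.

Let Tunit := teichmuller_unit locR hT.
Let TM := teichmullerM locR hT.
Let TV := teichmullerV locR hT.
Let TX := teichmullerX locR hT.

Lemma nT_equivbP a b :
  reflect (exists2 c, c \in T :\ 0 & forall i, b`_i * c ^+ n = a`_i * c ^+ i)
          (nT_equivb T a b).
Proof.
by apply: (iffP (asboolP _)) => /(nT_equivP n_gt0 Tunit).
Qed.

Lemma nT_equivb_sym : symmetric (nT_equivb T (n := n)).
Proof.
suff sub a b : nT_equivb T a b -> nT_equivb T b a.
  by move=> a b; apply/idP/idP; apply: sub.
case/nT_equivbP=> c Tc h; apply/nT_equivbP; exists c^-1; first exact: TV.
by move=> i; apply: scaled_coefV => //; apply: Tunit.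
Qed.

Lemma nT_equivb_trans : transitive (nT_equivb T (n := n)).
Proof.
move=> b a e /nT_equivbP[c Tc hc] /nT_equivbP[d Td hd].
apply/nT_equivbP; exists (c * d) => [|i]; first exact: TM.
by rewrite !exprMn [c ^+ n * _]mulrC mulrA hd mulrAC hc mulrA.
Qed.

Lemma nT_equivb_refl : reflexive (nT_equivb T (n := n)).
Proof.
move=> a; apply/nT_equivbP; exists 1; first exact: teichmuller1 locR hT.
by move=> i; rewrite !expr1n.
Qed.

Lemma nT_equivalence : equivalence_rel (nT_equivb T (n := n)).
Proof.
apply/equivalence_relP; split; first exact: nT_equivb_refl.
exact: sym_left_transitive nT_equivb_sym nT_equivb_trans.
Qed.

Lemma BTkP (k : nat) f : (0 < k < n)%N ->
  reflect [/\ f`_k \in T :\ 0, f`_0 \in T :\ 0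
            & forall i, i != k -> i != 0%N -> f`_i = 0]
          (f \in BTk T n k).
Proof.
move=> hk; rewrite [f \in _]inE; apply: (iffP andP).
  by case=> /(BP hk)[_ _ h] /andP[].
by case=> fk f0 h; split; [apply/(BP hk); split; rewrite ?Tunit | apply/andP].
Qed.

(** If j and k differed, the coefficient of degree j would be both a unit and zero. *)
Lemma BTk_disjoint (j k : nat) f : (0 < j < n)%N -> (0 < k < n)%N ->
  f \in BTk T n j -> f \in BTk T n k -> j = k.
Proof.
move=> hj hk /(BTkP _ hj)[fj _ _] /(BTkP _ hk)[_ _ h].
apply/eqP/negPn/negP => jk; have := Tunit fj.
by rewrite h ?unitr0 // -lt0n; case/andP: hj.
Qed.

Lemma BTP f :
  reflect (exists2 k : nat, (0 < k < n)%N & f \in BTk T n k) (f \in BT T n).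
Proof.
apply: (iffP bigcupP) => [[k k0 fk]|[k /andP[k0 kn] fk]].
  by exists k => //; rewrite k0 /=.
by exists (Ordinal kn).
Qed.

(** The relation b_i = a_i c^i / c^n keeps zero coefficients zero and coefficients of T^* in T^*. *)
Lemma BTk_equiv (k : nat) a b : (0 < k < n)%N ->
  nT_equivb T a b -> a \in BTk T n k -> b \in BTk T n k.
Proof.
move=> hk /nT_equivbP[c Tc hc] /(BTkP _ hk)[ak a0 h].
have uc := unitrX n (Tunit Tc).
have bE i : b`_i = a`_i * c ^+ i * (c ^+ n)^-1 by rewrite -hc mulrK.
have Tb i : a`_i \in T :\ 0 -> b`_i \in T :\ 0.
  by move=> Ta; rewrite bE !(TM, TV, TX).
apply/(BTkP _ hk); split; try exact: Tb.
by move=> i ik i0; rewrite bE h // !mul0r.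
Qed.

(** [equivalence_partition] cuts each class down to its domain. As classes never leave B_Tk, both
    domains give the same sets, so the partitions can be compared literally. *)
Lemma BT_class (k : nat) a : (0 < k < n)%N -> a \in BTk T n k ->
  [set b in BT T n | nT_equivb T a b] = [set b in BTk T n k | nT_equivb T a b].
Proof.
move=> hk ak; apply/setP=> b; rewrite [LHS]inE [RHS]inE; apply: andb_id2r => ab.
have bk := BTk_equiv hk ab ak; rewrite bk.
by apply/BTP; exists k.
Qed.

Lemma nT_classes_BT :
  nT_classes T (BT T n) = \bigcup_(k < n | (0 < k)%N) nT_classes T (BTk T n k).
Proof.
apply/setP=> C; apply/imsetP/bigcupP => [[a /bigcupP[k k0 ak] ->]|].
  by exists k => //; apply/imsetP; exists a; rewrite ?(BT_class (k := k)) ?k0 /=.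
case=> k k0 /imsetP[a ak ->].
by exists a; rewrite ?(BT_class (k := k)) ?k0 /=; first by apply/bigcupP; exists k.
Qed.

(** By reflexivity a class contains its representative, so a common class would put one element in
    both B_Tj and B_Tk. *)
Lemma nT_classes_disjoint (j k : nat) :
  (0 < j < n)%N -> (0 < k < n)%N -> j != k ->
  [disjoint nT_classes T (BTk T n j) & nT_classes T (BTk T n k)].
Proof.
move=> hj hk jk; rewrite disjoint_subset; apply/subsetP => C /imsetP[a aj ->].
rewrite inE; apply/negP => /imsetP[b _ eqC].
have : a \in [set y in BTk T n j | nT_equivb T a y].
  by rewrite inE aj nT_equivb_refl.
rewrite eqC inE => /andP[ak _].
by rewrite (BTk_disjoint hj hk aj ak) eqxx in jk.
Qed.

Lemma card_nT_classes_BT :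
  #|nT_classes T (BT T n)| =
  (\sum_(k < n | (0 < k)%N) #|nT_classes T (BTk T n k)|)%N.
Proof.
(* [big_mkcond] puts the empty set at index 0, so that disjointness holds for all pairs of
   indices. *)
rewrite nT_classes_BT big_mkcond -sum1_card partition_disjoint_bigcup.
  rewrite [RHS]big_mkcond; apply: eq_bigr => k _.
  by rewrite sum1_card; case: ifP; rewrite ?cards0.
move=> j k jk; case: ifP => j0; last by rewrite -setI_eq0 set0I.
case: ifP => k0; last by rewrite -setI_eq0 setI0.
by apply: nT_classes_disjoint; rewrite ?j0 ?k0 /=.
Qed.

(** * Classes in B_Tk as cosets of H_Tk *)

Section Binomial.
Variable k : nat.
Hypothesis hk : (0 < k < n)%N.

(** Only the degrees k and 0 impose a condition; in degree k the unit c^k cancels, which leaves the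
    exponent n - k. *)
Lemma nT_equiv_binomialP a b :
  (forall i, i != k -> i != 0%N -> a`_i = 0) ->
  (forall i, i != k -> i != 0%N -> b`_i = 0) ->
  nT_equiv T a b <->
  exists2 c, c \in T :\ 0 & b`_k * c ^+ (n - k) = a`_k /\ b`_0 * c ^+ n = a`_0.
Proof.
have /andP[k0 kn] := hk; move=> ha hb.
have nE c : c ^+ n = c ^+ (n - k) * c ^+ k :> R by rewrite -exprD subnK // ltnW.
split=> [/(nT_equivP n_gt0 Tunit)|] [c Tc].
  move=> hc; exists c => //; split; last by rewrite hc expr0 mulr1.
  by apply: (mulIr (unitrX k (Tunit Tc))); rewrite -mulrA -nE hc.
case=> bk b0; apply/(nT_equivP n_gt0 Tunit); exists c => // i.
case: (eqVneq i k) => [->|ik]; first by rewrite nE mulrA bk.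
case: (eqVneq i 0%N) => [->|i0]; first by rewrite b0 expr0 mulr1.
by rewrite ha // hb // !mul0r.
Qed.

(** The unit witnessing membership in [H] is replaced by its component in T^*, which has the same
    powers of exponents n - k and n because these lie in T^*. *)
Lemma HTkP f :
  reflect (exists2 c, c \in T :\ 0 &
             [/\ f`_k = c ^+ (n - k), f`_0 = c ^+ n
               & forall i, i != k -> i != 0%N -> f`_i = 0])
          (f \in HTk T n k).
Proof.
have /andP[k0 kn] := hk; have k0' : (k == 0)%N = false by case: (k) k0.
rewrite [f \in _]inE [f \in _]inE; apply: (iffP andP); last first.
  case=> c Tc [fk f0 h]; split; last by rewrite /coefs_in fk f0 !TX.
  apply/existsP; exists c; rewrite Tunit //=; apply/eqP/polyP => i.
  rewrite coefD coefZ coefXn coefC.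
  case: (eqVneq i k) => [->|ik]; first by rewrite k0' mulr1 addr0.
  case: (eqVneq i 0%N) => [->|i0]; first by rewrite mulr0 add0r.
  by rewrite mulr0 addr0 h.
case=> /existsP[e /andP[ue /eqP fE]].
have -> : coefs_in (T :\ 0) k f = (e ^+ (n - k) \in T :\ 0) && (e ^+ n \in T :\ 0).
  rewrite /coefs_in fE !coefD !coefZ !coefXn !coefC eqxx k0' eq_sym k0'.
  by rewrite mulr1 addr0 mulr0 add0r.
case/andP=> Tk T0; have [c Tc ce] := teichmuller_component locR hT ue.
exists c => //; rewrite -!ce //; split=> [||i /negPf ik /negPf i0].
- by rewrite fE coefD coefZ coefXn coefC eqxx k0' mulr1 addr0.
- by rewrite fE coefD coefZ coefXn coefC eq_sym k0' mulr0 add0r.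
by rewrite fE coefD coefZ coefXn coefC ik i0 mulr0 addr0.
Qed.

Lemma HTk_BTk f : f \in HTk T n k -> f \in BTk T n k.
Proof.
case/HTkP=> c Tc [fk f0 h]; apply/(BTkP _ hk).
by split=> //; rewrite ?fk ?f0 TX.
Qed.

Lemma star_BTk f g :
  f \in BTk T n k -> g \in BTk T n k -> star f g \in BTk T n k.
Proof.
move=> /(BTkP _ hk)[fk f0 hf] /(BTkP _ hk)[gk g0 _]; apply/(BTkP _ hk).
by split=> [||i ik i0]; rewrite coef_star ?TM // hf ?mul0r.
Qed.

Lemma star_HTk f g :
  f \in HTk T n k -> g \in HTk T n k -> star f g \in HTk T n k.
Proof.
move=> /HTkP[c Tc [fk f0 hf]] /HTkP[d Td [gk g0 _]]; apply/HTkP.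
exists (c * d); first exact: TM.
split=> [||i ik i0]; rewrite coef_star ?exprMn ?fk ?f0 ?gk ?g0 //.
by rewrite hf ?mul0r.
Qed.

Lemma nT_class_star a : a \in BTk T n k ->
  [set b in BTk T n k | nT_equivb T a b] = [set star a h | h in HTk T n k].
Proof.
have /andP[k0 kn] := hk; have k0' : (k == 0)%N = false by case: (k) k0.
move=> aB; have /(BTkP _ hk)[ak a0 ha] := aB.
apply/setP=> b; rewrite [LHS]inE; apply/andP/imsetP => [[bB]|[h hH ->]].
  have /(BTkP _ hk)[_ _ hb] := bB.
  (* Read from [b] to [a], the criterion expresses the coefficients of [b] as those of [a] times
     powers of [c], without inverses. *)
  rewrite nT_equivb_sym => /asboolP/(nT_equiv_binomialP hb ha)[c Tc [ck c0]].
  pose h := mk_npoly n (fun i => if i == k then c ^+ (n - k)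
                               else if i == 0%N then c ^+ n else 0).
  exists h.
    apply/HTkP; exists c => //.
    split=> [||i /negPf ik /negPf i0]; rewrite coef_poly ?kn ?eqxx //.
      by rewrite n_gt0 eq_sym k0'.
    by rewrite ik i0 if_same.
  apply/npolyP => i; rewrite coef_star coef_poly.
  case: (eqVneq i k) => [->|ik]; first by rewrite kn ck.
  case: (eqVneq i 0%N) => [->|i0]; first by rewrite n_gt0 c0.
  by rewrite hb // if_same mulr0.
have sB := star_BTk aB (HTk_BTk hH); split=> //.
have /(BTkP _ hk)[_ _ hs] := sB.
rewrite nT_equivb_sym; apply/asboolP/(nT_equiv_binomialP hs ha).
by case/HTkP: hH => c Tc [hk' h0 _]; exists c => //; rewrite !coef_star hk' h0.
Qed.

(** Multiplication by [a] is injective on H_Tk: its coefficients in degrees k and 0 are units, and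
    elements of H_Tk vanish in all other degrees. *)
Lemma card_nT_class a : a \in BTk T n k ->
  #|[set b in BTk T n k | nT_equivb T a b]| = #|HTk T n k|.
Proof.
move=> aB; rewrite nT_class_star // card_in_imset // => f g.
move=> /HTk_BTk/(BTkP _ hk)[_ _ hf] /HTk_BTk/(BTkP _ hk)[_ _ hg] eqs.
have /(BTkP _ hk)[ak a0 _] := aB.
have eqc i : a`_i * f`_i = a`_i * g`_i by rewrite -!coef_star eqs.
apply/npolyP => i; case: (eqVneq i k) => [->|ik].
  by apply: (mulrI (Tunit ak)).
case: (eqVneq i 0%N) => [->|i0]; first by apply: (mulrI (Tunit a0)).
by rewrite hf ?hg.
Qed.

Lemma card_BTk :
  #|BTk T n k| = (#|nT_classes T (BTk T n k)| * #|HTk T n k|)%N.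
Proof.
apply: card_uniform_partition.
  by move=> C /imsetP[a aB ->]; apply: card_nT_class.
by apply: equivalence_partitionP => a b f _ _ _; apply: nT_equivalence.
Qed.

Lemma npoly1_HTk : val (Bgroup_one R hk) \in HTk T n k.
Proof.
apply/HTkP; exists 1; first exact: teichmuller1 locR hT.
rewrite !expr1n; split=> [||i /negPf ik /negPf i0]; rewrite coef_Bone ?eqxx ?orbT //.
by rewrite ik i0.
Qed.

(** The sets of polynomials are pulled back to subgroups of [Bgroup], where the index is the
    quotient of the orders; [card_BTk] computes that quotient. *)
Lemma card_nT_classes_BTk :
  #|nT_classes T (BTk T n k)| =
  #|[set u : Bgroup R hk | val u \in BTk T n k]
     : [set u : Bgroup R hk | val u \in HTk T n k]|%g.
Proof.
pose restr (A : {set {poly_n R}}) := [set u : Bgroup R hk | val u \in A].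
have restrE A u : (u \in restr A) = (val u \in A) by rewrite inE.
(* By finiteness, the identity and closure under products suffice for a subgroup. *)
have gH : group_set (restr (HTk T n k)).
  apply/group_setP; split=> [|u v]; first by rewrite restrE npoly1_HTk.
  by rewrite !restrE; apply: star_HTk.
have gB : group_set (restr (BTk T n k)).
  apply/group_setP; split=> [|u v]; first by rewrite restrE (HTk_BTk npoly1_HTk).
  by rewrite !restrE; apply: star_BTk.
(* Pulling back along the injection [val] preserves cardinality for sets inside its image
   [B R n k]. *)
have card_restr (A : {set {poly_n R}}) : A \subset B R n k -> #|restr A| = #|A|.
  move=> /subsetP sAB; rewrite -(card_imset _ val_inj); apply: eq_card => f.
  apply/imsetP/idP => [[u + ->]|fA]; first by rewrite restrE.
  by exists (exist (fun g => is_true (g \in B R n k)) f (sAB f fA)); rewrite ?restrE.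
have sBB : BTk T n k \subset B R n k.
  by apply/subsetP => f; rewrite inE => /andP[].
have sHB : HTk T n k \subset BTk T n k by apply/subsetP => f /HTk_BTk.
have sub : Group gH \subset Group gB.
  by apply/subsetP => u; rewrite !restrE; apply: HTk_BTk.
rewrite -[RHS](divgS sub) /= !card_restr ?(subset_trans sHB) //.
rewrite card_BTk mulnK //.
by rewrite -(card_restr _ (subset_trans sHB sBB)) (cardG_gt0 (Group gH)).
Qed.

End Binomial.
End Classes.


Theorem proposition15 (R : finComUnitRingType) (T : {set R}) (n : nat)
    (hR : finite_chain_ring R) (hT : teichmuller_set T) (hn : (2 <= n)%N) :
  (* (i) *)
  (forall a b : {poly_n R}, a \in BT T n -> b \in BT T n ->
     nT_equiv T a b ->
     exists k : nat, [/\ (0 < k < n)%N, a \in BTk T n k & b \in BTk T n k])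
  (* (ii) *)
  /\ ((forall k : nat, (0 < k < n)%N ->
         {in BTk T n k & &, equivalence_rel (nT_equivb T (n := n))})
      /\ nT_classes T (BT T n) =
           \bigcup_(k < n | (0 < k)%N) nT_classes T (BTk T n k)
      /\ (forall j k : nat, (0 < j < n)%N -> (0 < k < n)%N -> j != k ->
            [disjoint nT_classes T (BTk T n j) & nT_classes T (BTk T n k)]))
  (* (iii) *)
  /\ #|nT_classes T (BT T n)| =
       (\sum_(k < n | (0 < k)%N) #|nT_classes T (BTk T n k)|)%N
  (* (iv) *)
  /\ (forall (k : nat) (a b : {poly_n R}) (a1 a0 b1 b0 : R),
        (0 < k < n)%N -> a \in BT T n -> b \in BT T n ->
        (a : {poly R}) = a1 *: 'X^k + a0%:P ->
        (b : {poly R}) = b1 *: 'X^k + b0%:P ->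
        (nT_equiv T a b <->
         exists2 alpha : R, alpha \in T :\ 0 &
           b1 * alpha ^+ (n - k) - a1 = 0 /\ b0 * alpha ^+ n - a0 = 0))
  (* (v) *)
  /\ (forall (k : nat) (a : {poly_n R}),
        (0 < k < n)%N -> a \in BTk T n k ->
        [set b in BT T n | nT_equivb T a b] = [set star a h | h in HTk T n k]
        /\ #|[set b in BT T n | nT_equivb T a b]| = #|HTk T n k|)
  (* (vi) *)
  /\ (forall (k : nat) (hk : (0 < k < n)%N),
        #|nT_classes T (BTk T n k)| =
        #|[set u : Bgroup R hk | val u \in BTk T n k]
           : [set u : Bgroup R hk | val u \in HTk T n k]|%g).
Proof.
have [locR _] := hR; have n_gt0 : (0 < n)%N := ltnW hn.
split=> [a b /BTP[k hk ak] _ ab|].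
  exists k; split=> //; apply: (BTk_equiv locR hT n_gt0 hk _ ak).
  exact/asboolP.
split; first split=> [k _ a b f _ _ _|].
- exact: nT_equivalence.
- split; first exact: nT_classes_BT.
  exact: nT_classes_disjoint.
split; first exact: card_nT_classes_BT.
split=> [k a b a1 a0 b1 b0 hk _ _ aE bE|].
  have /andP[k_gt0 _] := hk; have k_neq0 : (k == 0)%N = false by rewrite gtn_eqF.
  have coefE (f : {poly_n R}) f1 f0 : (f : {poly R}) = f1 *: 'X^k + f0%:P ->
      [/\ f`_k = f1, f`_0 = f0 & forall i, i != k -> i != 0%N -> f`_i = 0].
    move=> ->; split=> [||i /negPf ik /negPf i0]; rewrite coefD coefZ coefXn coefC.
    - by rewrite eqxx k_neq0 mulr1 addr0.
    - by rewrite eq_sym k_neq0 mulr0 add0r.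
    - by rewrite ik i0 mulr0 addr0.
  have [<- <- ha] := coefE _ _ _ aE; have [<- <- hb] := coefE _ _ _ bE.
  rewrite (nT_equiv_binomialP locR hT n_gt0 hk ha hb).
  by split=> -[c Tc [ck c0]]; exists c => //; split; apply/eqP;
    move/eqP: ck; move/eqP: c0; rewrite ?subr_eq0.
split=> [k a hk ak|k hk]; last exact: card_nT_classes_BTk.
(* The class over B_T is first identified with the class over B_Tk. *)
rewrite (BT_class locR hT n_gt0 hk ak); split; first exact: nT_class_star.
exact: card_nT_class.
Qed.
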